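(* Let $v\in L^1_{\rm loc}(\Omega)$ be a vector field such that $\omega\equiv\operatorname{curl}v\in\mathcal{BM}(\Omega)$. Then the circulations $\gamma_1,\dots,\gamma_k$ of $v$ on the connected components $\Gamma_1,\dots,\Gamma_k$ of the boundary are well defined through the following formula: there exist unique real numbers $\gamma_1,\dots,\gamma_k$ such that $$\int_\Omega\varphi\,d\omega+\int_\Omega v\cdot\nabla^\perp\varphi\,dx=-\sum_{j=1}^k\gamma_j\,\varphi\big|_{\Gamma_j}$$ for all $\varphi\in\mathcal Y^\infty$.
   Context: $\Omega\subset\mathbb{R}^2$ is a smooth exterior domain: an open set with smooth boundary such that $\mathbb{R}^2\setminus\overline\Omega$ is the union of $k\ge 1$ bounded, simply connected, smooth open sets $\Omega_1,\dots,\Omega_k$ with pairwise disjoint closures; $\Gamma_j=\partial\Omega_j$. It is assumed throughout that $B(0;1)\subset\Omega_1$. $\nabla^\perp=(-\partial_{x_2},\partial_{x_1})$; $\operatorname{curl}v=\partial_{x_1}v_2-\partial_{x_2}v_1$ in the sense of distributions. $\mathcal{BM}(\Omega)$ is the space of bounded (signed) Radon measures on $\Omega$. $\mathcal Y^\infty$ is the space of functions $f\in C^\infty(\overline\Omega)$ with bounded support such that $f$ is constant in a neighborhood of each $\Gamma_j$ (with a constant depending on $j$). *)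

(* Defs.v *)
From HB Require Import structures.
From mathcomp Require Import all_boot all_order all_algebra.
From mathcomp Require Import all_classical all_reals all_analysis.

Set Implicit Arguments.
Unset Strict Implicit.
Unset Printing Implicit Defensive.

Import Order.TTheory GRing.Theory Num.Theory.
Import numFieldNormedType.Exports.

Local Open Scope classical_set_scope.
Local Open Scope ring_scope.

(* [plane R] carries the topology and the norm (the sup norm, which induces the
   usual topology of R^2); the convertible type [mplane R] carries the Borel
   sigma-algebra. *)
Notation plane R := (R * R)%type.
Notation mplane R := (measurableTypeR R * measurableTypeR R)%type.

Definition lebesgue2 (R : realType) : {measure set (mplane R) -> \bar R} :=
  (@lebesgue_measure R \x @lebesgue_measure R)%E.

Definition boundary (T : topologicalType) (A : set T) : set T :=
  closure A `\` A°.

(** Smoothness *)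

Definition axis (R : realType) (i : bool) : plane R :=
  if i then (0, 1) else (1, 0).

Definition partial1 (R : realType) (f : plane R -> R) : plane R -> R :=
  'D_(axis R false) f.

Definition partial2 (R : realType) (f : plane R -> R) : plane R -> R :=
  'D_(axis R true) f.

Definition iter_partial (R : realType) (s : seq bool) (f : plane R -> R) :
    plane R -> R :=
  foldr (fun i g => if i then partial2 g else partial1 g) f s.

(* C^oo on the open set U: all iterated partial derivatives exist and are
   continuous on U. *)
Definition smooth_on (R : realType) (U : set (plane R)) (f : plane R -> R) :=
  forall (s : seq bool) (x : plane R), U x ->
    {for x, continuous (iter_partial s f)} /\
    (forall i, derivable (iter_partial s f) x (axis R i)).

(* C^oo of the closure of U: restrictions to that closure of functions that are
   C^oo on the plane. *)
Definition smooth_up_to_boundary (R : realType) (U : set (plane R))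
    (f : plane R -> R) :=
  exists2 g, smooth_on setT g & forall x, closure U x -> f x = g x.

Definition smooth_real_function (R : realType) (g : R -> R) :=
  forall (n : nat) (x : R), derivable (derive1n n g) x 1.

(* Near each of its boundary points, A is the set lying strictly on one side of
   the graph of a smooth function, after possibly exchanging the coordinates
   ([swap]) and reversing the orientation of the second one ([flip]). *)
Definition smooth_boundary (R : realType) (A : set (plane R)) :=
  forall p, boundary A p ->
    exists (g : R -> R) (swap flip : bool), smooth_real_function g /\
      \forall x \near p,
        A x <-> let y := if swap then (x.2, x.1) else x in
                g y.1 < (-1) ^+ flip * y.2.

(** Simple connectedness *)

Definition path_in (R : realType) (U : set (plane R)) (c : R -> plane R) :=
  {within `[0, 1]%classic, continuous c} /\ forall t, t \in `[0, 1] -> U (c t).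

Definition path_connected (R : realType) (U : set (plane R)) :=
  forall x y, U x -> U y ->
    exists c : R -> plane R, [/\ path_in U c, c 0 = x & c 1 = y].

Definition null_homotopic (R : realType) (U : set (plane R))
    (c : R -> plane R) :=
  exists H : plane R -> plane R,
    [/\ {within `[0, 1]%classic `*` `[0, 1]%classic, continuous H},
        forall t s, t \in `[0, 1] -> s \in `[0, 1] -> U (H (t, s)),
        forall t, t \in `[0, 1] -> H (t, 0) = c t,
        forall t, t \in `[0, 1] -> H (t, 1) = c 0 &
        forall s, s \in `[0, 1] -> H (0, s) = c 0 /\ H (1, s) = c 0].

Definition simply_connected (R : realType) (U : set (plane R)) :=
  [/\ U !=set0, path_connected U &
      forall c : R -> plane R, path_in U c -> c 0 = c 1 ->
        null_homotopic U c].

(** Exterior domains *)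

Record smooth_exterior_domain (R : realType) (k : nat) (Om : set (plane R))
    (Omj : 'I_k -> set (plane R)) : Prop := SmoothExteriorDomain {
  sed_open : open Om;
  sed_smooth : smooth_boundary Om;
  sed_hole_open : forall j, open (Omj j);
  sed_hole_bounded : forall j, bounded_set (Omj j);
  sed_hole_simply_connected : forall j, simply_connected (Omj j);
  sed_hole_smooth : forall j, smooth_boundary (Omj j);
  sed_hole_disjoint : forall i j, i != j ->
    closure (Omj i) `&` closure (Omj j) = set0;
  sed_hole_cover : ~` closure Om = \bigcup_j Omj j }.

Definition unit_disk (R : realType) : set (plane R) :=
  [set x | x.1 ^+ 2 + x.2 ^+ 2 < 1].

(** Bounded Radon measures *)

(* A charge is a finite signed measure; on Borel sets of the plane it is
   automatically Radon.  An element of BM(Om) is identified with its extension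
   by zero outside Om. *)
Definition charge_on (R : realType) (Om : set (plane R))
    (w : {charge set (mplane R) -> \bar R}) :=
  forall A : set (mplane R), measurable A -> A `&` Om = set0 -> w A = 0%E.

(* Integral over D against the Jordan decomposition of w.  That decomposition
   does not depend on the Hahn decomposition picked by [cid]. *)
Definition charge_integral d (T : measurableType d) (R : realType)
    (w : {charge set T -> \bar R}) (D : set T) (f : T -> R) : R :=
  let P := cid (Hahn_decomposition w) in
  let N := cid (svalP P) in
  \int[jordan_pos (svalP N)]_(x in D) f x -
  \int[jordan_neg (svalP N)]_(x in D) f x.

(** Vector fields *)

Definition L1loc (R : realType) (Om : set (plane R)) (f : plane R -> R) :=
  measurable_fun (Om : set (mplane R)) (f : mplane R -> R) /\
  forall K : set (plane R), compact K -> K `<=` Om ->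
    (lebesgue2 R).-integrable (K : set (mplane R)) (fun x => (f x)%:E).

Definition L1loc_field (R : realType) (Om : set (plane R))
    (v : plane R -> plane R) :=
  L1loc Om (fun x => (v x).1) /\ L1loc Om (fun x => (v x).2).

Definition dot (R : realType) (a b : plane R) : R := a.1 * b.1 + a.2 * b.2.

Definition grad_perp (R : realType) (f : plane R -> R) (x : plane R) :
    plane R :=
  (- partial2 f x, partial1 f x).

Definition test_function (R : realType) (Om : set (plane R))
    (f : plane R -> R) :=
  [/\ smooth_on setT f, compact (closure [set x | f x != 0]) &
      closure [set x | f x != 0] `<=` Om].

(* d_1 v_2 - d_2 v_1 = w as distributions on Om. *)
Definition curl_is (R : realType) (Om : set (plane R))
    (v : plane R -> plane R) (w : {charge set (mplane R) -> \bar R}) :=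
  forall f, test_function Om f ->
    - (\int[lebesgue2 R]_(x in Om) ((v x).2 * partial1 f x))
    + \int[lebesgue2 R]_(x in Om) ((v x).1 * partial2 f x)
    = charge_integral w Om f.

(** The test space Y^oo *)

(* Only the values of f on the closure of Om matter. *)
Definition Yoo (R : realType) (k : nat) (Om : set (plane R))
    (Omj : 'I_k -> set (plane R)) (f : plane R -> R) :=
  [/\ smooth_up_to_boundary Om f,
      bounded_set [set x | closure Om x /\ f x != 0] &
      forall j, exists (U : set (plane R)) (c : R),
        [/\ open U, boundary (Omj j) `<=` U &
            forall x, U x -> closure Om x -> f x = c]].

(* The value of f on G, when f is constant on G. *)
Definition value_on (R : realType) (f : plane R -> R) (G : set (plane R)) : R :=
  xget 0 [set c | forall x, G x -> f x = c].

(* Main.v *)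
Require Import Defs.
From HB Require Import structures.
From mathcomp Require Import all_boot all_order all_algebra.
From mathcomp Require Import all_classical all_reals all_analysis.
From mathcomp Require Import ring lra.

Set Implicit Arguments.
Unset Strict Implicit.
Unset Printing Implicit Defensive.

Import Order.TTheory GRing.Theory Num.Theory.
Import numFieldNormedType.Exports.
Local Open Scope classical_set_scope.
Local Open Scope ring_scope.

(** Put L phi = \int phi dw + \int v . grad_perp phi, the defect in Green's
formula ([curl_defect] below).  It is finite and linear on the test space: phi
is locally constant near the boundary of Om and outside a bounded set, so the
gradient of phi lives on a compact subset of Om, where v is integrable
([Yoo_locally_constant], [curl_defect_linear]).

If phi vanishes near every hole boundary, then phi extended by zero is a test
function on Om, and L phi = 0 is the distributional identity curl v = w
([curl_defect_trace0]).  Hence L phi only depends on the k boundary values of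
phi.  For each hole j there is a chi_j in the test space with boundary value 1
on that hole and 0 on the others ([Yoo_cutoff]); subtracting from phi the
combination of the chi_j with the same boundary values gives
L phi = \sum_j phi|_j L chi_j.  So gamma_j = - L chi_j works, and testing with
chi_j shows that it is the only choice.

Two facts make this rigorous.  Cutoffs: exp (-1/t), extended by zero to t <= 0,
is smooth because its derivatives stay in the family p(1/t) exp (-1/t) with p a
polynomial ([is_derive_flat]); from it one gets a smooth step, a bump on a
square, and, by compactness, a cutoff around any compact set
([exists_cutoff]).  Topology: the boundary of Om is exactly the union of the
hole boundaries ([hole_boundary_sub], [domain_boundary_sub]), and each of these
is nonempty ([hole_boundary_nonempty]), so that the value of a test function on
it is determined. *)

(** * Closure properties of smooth functions on the plane *)

(** Coinduction for smoothness: iterated derivatives never leave S, so it is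
enough to control one derivative of each member. *)
Lemma smooth_onT_invariant (R : realType) (S : (plane R -> R) -> Prop) :
  (forall f, S f -> [/\ continuous f,
     forall x i, derivable f x (axis R i) & forall i, S ('D_(axis R i) f)]) ->
  forall f, S f -> smooth_on setT f.
Proof.
move=> invS f Sf s x _.
have : S (iter_partial s f).
  by elim: s => [//|[] s IHs] /=; case: (invS _ IHs) => _ _; exact.
by move=> /invS[cf df _]; split=> [|i]; [exact: cf|exact: df].
Qed.

Lemma smooth_onT_derive (R : realType) (f : plane R -> R) i :
  smooth_on setT f -> smooth_on setT ('D_(axis R i) f).
Proof.
move=> smf s x _; have := smf (rcons s i) x I.
by rewrite /iter_partial -cats1 foldr_cat; case: i.
Qed.

Lemma smooth_onT_continuous (R : realType) (f : plane R -> R) :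
  smooth_on setT f -> continuous f.
Proof. by move=> smf x; case: (smf [::] x I). Qed.

Lemma smooth_onT_derivable (R : realType) (f : plane R -> R) x i :
  smooth_on setT f -> derivable f x (axis R i).
Proof. by move=> smf; case: (smf [::] x I). Qed.

(** The algebra generated by the smooth functions, with inverses of nowhere
vanishing members.  The Leibniz and quotient rules express the partial
derivatives of a member in the same algebra, which makes it an invariant class
for [smooth_onT_invariant] and avoids any formula for higher derivatives. *)
Inductive smooth_alg (R : realType) : (plane R -> R) -> Prop :=
| SmoothBase f : smooth_on setT f -> smooth_alg f
| SmoothCst c : smooth_alg (cst c)
| SmoothAdd f g : smooth_alg f -> smooth_alg g -> smooth_alg (f + g)
| SmoothMul f g : smooth_alg f -> smooth_alg g -> smooth_alg (f * g)
| SmoothInv f : (forall x, f x != 0) -> smooth_alg f ->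
    smooth_alg (fun x => (f x)^-1).

Lemma smooth_alg_smooth (R : realType) (f : plane R -> R) :
  smooth_alg f -> smooth_on setT f.
Proof.
move: f; apply: smooth_onT_invariant => f.
elim=> {f} [f smf|c|f g _ [cf df Sf] _ [cg dg Sg]|
    f g algf [cf df Sf] algg [cg dg Sg]|f f0 algf [cf df Sf]].
- split=> [|x i|i]; first exact: smooth_onT_continuous.
  + exact: smooth_onT_derivable.
  + by apply: SmoothBase; exact: smooth_onT_derive.
- split=> [x|x i|i]; first exact: cst_continuous.
  + exact: derivable_cst.
  + rewrite (_ : 'D__ _ = cst 0); first exact: SmoothCst.
    by apply/funext => x; rewrite derive_cst.
- split=> [x|x i|i]; first by apply: (@continuousD _ _ _ f g x); [exact: cf|exact: cg].
  + exact: derivableD.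
  + rewrite (_ : 'D__ _ = 'D_(axis R i) f + 'D_(axis R i) g).
      exact: SmoothAdd.
    by apply/funext => x; rewrite deriveD.
- split=> [x|x i|i]; first by apply: (@continuousM _ _ f g x); [exact: cf|exact: cg].
  + exact: derivableM.
  + rewrite (_ : 'D__ _ = f * 'D_(axis R i) g + g * 'D_(axis R i) f).
      by apply: SmoothAdd; apply: SmoothMul.
    by apply/funext => x; rewrite deriveM.
- split=> [x|x i|i]; first by apply: continuousV => //; exact: cf.
  + exact: derivableV.
  + have algV : smooth_alg (fun x => (f x)^-1) by exact: SmoothInv.
    rewrite (_ : 'D__ _ = cst (-1) * ((fun x => (f x)^-1) * (fun x => (f x)^-1))
      * 'D_(axis R i) f).
      by do !apply: SmoothMul => //; exact: SmoothCst.
    apply/funext => x; rewrite deriveV//.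
    by rewrite /GRing.scale/= !fctE mulN1r expr2 invfM.
Qed.

(** Nearness at x is nearness at all points close to x, so it passes to a
derivative and hence to all of them. *)
Lemma near_eq_iter_partial (R : realType) (s : seq bool) (f g : plane R -> R)
    (x : plane R) :
  (\near x, f x = g x) -> \near x, iter_partial s f x = iter_partial s g x.
Proof.
have D (h k : plane R -> R) v (y : plane R) : (\near y, h y = k y) ->
    \near y, 'D_v h y = 'D_v k y.
  move=> /nbhs_interior; apply: filterS => z /=; exact: near_eq_derive.
by elim: s => [//|[] s IHs] /= /IHs; exact: D.
Qed.

Lemma smooth_onT_local (R : realType) (f : plane R -> R) :
  (forall x : plane R, exists2 g, smooth_on setT g & \near x, f x = g x) ->
  smooth_on setT f.
Proof.
move=> floc s x _; have [g gs fg] := floc x.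
have [gc gd] := gs s x I.
have E : \near x, iter_partial s g x = iter_partial s f x.
  by apply: near_eq_iter_partial; apply: filterS fg.
split=> [|i]; last exact: near_eq_derivable E (gd i).
rewrite /prop_for /continuous_at -(nbhs_singleton E).
by apply: cvg_trans gc; exact: near_eq_cvg.
Qed.

(** * Flat functions and cutoffs *)

(** Each monomial is bounded by a term of the exponential series. *)
Lemma poly_le_expR (R : realType) (q : {poly R}) :
  exists2 C : R, 0 <= C & forall s, 0 <= s -> `|q.[s]| <= C * expR s.
Proof.
have expn i (s : R) : 0 <= s -> s ^+ i <= i`!%:R * expR s.
  move=> s0; case: i => [|i].
    by rewrite expr0 mul1r -expR0 ler_expR.
  rewrite mulrC -ler_pdivrMr ?ltr0n ?fact_gt0//.
  by apply: le_trans (expR_ge1Dxn i s0); rewrite lerDr.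
exists (\sum_(i < size q) `|q`_i| * i`!%:R).
  by apply: sumr_ge0 => i _; rewrite mulr_ge0.
move=> s s0; rewrite horner_coef (le_trans (ler_norm_sum _ _ _))//.
rewrite mulr_suml ler_sum// => i _.
by rewrite normrM normrX (ger0_norm s0) -mulrA ler_wpM2l// expn.
Qed.

(** All derivatives of [flat 1] have the form [flat p]; keeping p as a
parameter makes the family stable under derivation. *)
Definition flat (R : realType) (p : {poly R}) (t : R) : R :=
  if 0 < t then p.[t^-1] * expR (- t^-1) else 0.

(** The quadratic bound is what gives derivative 0 at the origin. *)
Lemma flat_le_sqr (R : realType) (p : {poly R}) :
  exists2 C : R, 0 <= C & forall t, `|flat p t| <= C * t ^+ 2.
Proof.
have [C C0 Cq] := poly_le_expR (p * 'X^2).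
exists C => // t; rewrite /flat; case: ifPn => [t0|_]; last first.
  by rewrite normr0 mulr_ge0// sqr_ge0.
have := Cq t^-1; rewrite invr_ge0 => /(_ (ltW t0)).
rewrite hornerM hornerXn normrM (ger0_norm (sqr_ge0 _)) exprVn => le.
rewrite normrM expRN normfV (ger0_norm (expR_ge0 _)).
rewrite ler_pdivrMr ?expR_gt0// mulrAC.
by rewrite -ler_pdivrMr ?exprn_gt0.
Qed.

(** For t > 0 the polynomial comes from differentiating p(u) exp (-u) at
u = 1/t, with du/dt = - u^2; for t < 0 the function is locally 0, and at 0
its quadratic bound applies. *)
Lemma is_derive_flat (R : realType) (p : {poly R}) (t : R) :
  is_derive t 1 (flat p) (flat ((p - p^`()) * 'X^2) t).
Proof.
have [t0|t0|->] := ltgtP t 0.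
- have E : \near t, cst 0 t = flat p t.
    near=> s; rewrite /flat ifF//; apply/negbTE; rewrite -leNgt ltW//.
    by near: s; exact: lt_nbhsl.
  rewrite /flat ltNge (ltW t0)/=.
  apply: DeriveDef; first exact: near_eq_derivable E (derivable_cst _ _ _).
  by rewrite -(near_eq_derive _ E) derive_cst.
- pose F u := p.[u] * expR (- u).
  pose f s := F s^-1.
  have E : \near t, f t = flat p t.
    near=> s; rewrite /flat ifT//.
    by near: s; exact: lt_nbhsr.
  have dN (u : R) : is_derive u 1 (expR \o -%R) (- expR (- u)).
    by apply: is_derive_eq; rewrite mulrN1.
  have dF (u : R) : is_derive u 1 F ((p^`() - p).[u] * expR (- u)).
    rewrite (_ : F = horner p * (expR \o -%R))//.
    apply: is_derive_eq.
    rewrite /GRing.scale/= hornerD hornerN; ring.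
  have dV : is_derive t 1 (fun s : R => s^-1) (- t ^- 2).
    apply: is_derive_eq; first by apply: is_deriveV; rewrite gt_eqF.
    by rewrite /GRing.scale/= mulr1.
  have df : is_derive t 1 f (flat ((p - p^`()) * 'X^2) t).
    rewrite (_ : f = F \o (fun s : R => s^-1))//.
    apply: is_derive_eq.
    rewrite /flat t0 hornerM hornerXn !hornerD !hornerN exprVn; ring.
  exact: near_eq_is_derive E df.
- have -> : flat ((p - p^`()) * 'X^2) 0 = 0 by rewrite /flat ltxx.
  have [C C0 Cf] := flat_le_sqr p.
  suff H : (fun h => h^-1 *: ((flat p \o shift 0) (h *: 1) - flat p 0)) @ 0^'
      --> (0 : R).
    by apply: DeriveDef; [apply/cvg_ex; exists 0|exact: cvg_lim H].
  apply: norm_cvg0.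
  apply: (@squeeze_cvgr _ _ _ _ (cst 0) (fun h : R => C * `|h|)).
  + near=> h; rewrite normr_ge0/=.
    have h0 : h != 0 by near: h; exact: nbhs_dnbhs_neq.
    rewrite /= addr0 {2}/flat ltxx subr0 [h *: 1]mulr1 normrM normrV ?unitfE//.
    rewrite ler_pdivrMl ?normr_gt0// (le_trans (Cf h))//.
    by rewrite [leRHS]mulrCA -expr2 real_normK ?num_real.
  + exact: cvg_cst.
  + rewrite -[X in _ --> X](mulr0 C); apply: cvgM; first exact: cvg_cst.
    have := @norm_continuous _ R 0; rewrite /continuous_at normr0.
    exact: cvg_within_filter.
Unshelve. all: by end_near. Qed.

Lemma is_derive_comp_affine (R : realType) (f : R -> R) (l : plane R -> R)
    (x v : plane R) (m d : R) :
  (forall h, l (h *: v + x) = h * m + l x) -> is_derive (l x) 1 f d ->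
  is_derive x v (f \o l) (d * m).
Proof.
move=> lE df; pose g h := h * m + l x.
have dg : is_derive (0 : R) (1 : R) g m.
  rewrite (_ : g = (m \*o id) + cst (l x)); last first.
    by apply/funext => h; rewrite /g mulrC.
  apply: is_derive_eq.
  by rewrite addr0 /GRing.scale/= mulr1.
have fg : is_derive (0 : R) (1 : R) (f \o g) (d * m).
  by apply: is_derive1_comp; rewrite /g mul0r add0r.
have E : (fun h => (f \o l) (h *: v + x)) = f \o g.
  by apply/funext => h /=; rewrite lE.
apply: DeriveDef; first by apply/derivable1P; rewrite E; case: fg.
case: fg => _ <-; rewrite -E /derive.
set g1 := fun h => h^-1 *: _; set g2 := fun h => h^-1 *: _.
suff -> : g1 = g2 by [].
by apply/funext => h; rewrite /g1 /g2/= addr0 scale0r add0r [h%:A]mulr1.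
Qed.

Lemma flat_continuous (R : realType) (p : {poly R}) : continuous (flat p).
Proof.
move=> t; apply/differentiable_continuous/derivable1_diffP.
by case: (is_derive_flat p t).
Qed.

Definition affine_form (R : realType) (a b c : R) (x : plane R) : R :=
  a * x.1 + b * x.2 + c.

Lemma affine_form_continuous (R : realType) (a b c : R) :
  continuous (affine_form a b c).
Proof.
move=> x; apply: cvgD; last exact: cvg_cst.
apply: cvgD; apply: cvgM; try exact: cvg_cst.
- exact: cvg_fst.
- exact: cvg_snd.
Qed.

Lemma smooth_flat_affine (R : realType) (p : {poly R}) (a b c : R) :
  smooth_on setT (flat p \o affine_form a b c).
Proof.
pose S (f : plane R -> R) := exists q, f = flat q \o affine_form a b c.
apply: (@smooth_onT_invariant _ S); last by exists p.
move=> _ [q ->].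
have D x i : is_derive x (axis R i) (flat q \o affine_form a b c)
    (flat ((q - q^`()) * 'X^2) (affine_form a b c x) * (if i then b else a)).
  apply: is_derive_comp_affine; last exact: is_derive_flat.
  by move=> h; rewrite /affine_form; case: i => /=;
    rewrite /GRing.scale/=; ring.
split=> [x|x i|i]; [|by case: (D x i)|].
- apply: continuous_comp; first exact: affine_form_continuous.
  exact: flat_continuous.
- exists ((if i then b else a) *: ((q - q^`()) * 'X^2)).
  apply/funext => x; case: (D x i) => _ -> /=.
  by rewrite /flat; case: ifPn => _; rewrite ?mul0r// hornerZ mulrC mulrA.
Qed.

Lemma flat1_gt0 (R : realType) (t : R) : 0 < t -> 0 < flat 1 t.
Proof. by move=> t0; rewrite /flat t0 hornerC mul1r expR_gt0. Qed.

Lemma flat_le0 (R : realType) (p : {poly R}) (t : R) : t <= 0 -> flat p t = 0.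
Proof. by move=> t0; rewrite /flat ltNge t0. Qed.

Lemma flat1_ge0 (R : realType) (t : R) : 0 <= flat 1 t.
Proof.
have [/flat_le0->//|/flat1_gt0/ltW] := leP t 0; exact.
Qed.

(** The denominator never vanishes since t and 1 - t are not both
nonpositive. *)
Definition step (R : realType) (t : R) : R :=
  flat 1 t / (flat 1 t + flat 1 (1 - t)).

Lemma step_denom_gt0 (R : realType) (t : R) :
  0 < flat 1 t + flat 1 (1 - t) :> R.
Proof.
have [t0|t0] := ltP 0 t; first by rewrite ltr_pwDl ?flat1_gt0 ?flat1_ge0.
by rewrite ltr_pwDr ?flat1_gt0 ?flat1_ge0//; lra.
Qed.

Lemma step_le0 (R : realType) (t : R) : t <= 0 -> step t = 0.
Proof. by move=> t0; rewrite /step (flat_le0 _ t0) mul0r. Qed.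

Lemma step_ge1 (R : realType) (t : R) : 1 <= t -> step t = 1.
Proof.
move=> t1; have := step_denom_gt0 t.
by rewrite /step (@flat_le0 _ _ (1 - t)) ?subr_le0// addr0 => /lt0r_neq0/divff.
Qed.

Lemma smooth_step_affine (R : realType) (a b c : R) :
  smooth_alg (@step R \o affine_form a b c).
Proof.
pose f := flat 1 \o affine_form a b c.
pose g := flat 1 \o affine_form (- a) (- b) (1 - c).
have E : f + g = fun x => flat 1 (affine_form a b c x) + flat 1 (1 - affine_form a b c x).
  apply/funext => x; rewrite /f /g !fctE/=; congr (_ + flat _ _).
  by rewrite /affine_form; ring.
rewrite (_ : _ \o _ = f * (fun x => ((f + g) x)^-1)); last by rewrite E.
apply: SmoothMul; first by apply: SmoothBase; exact: smooth_flat_affine.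
apply: SmoothInv => [x|]; first by rewrite E/= gt_eqF// step_denom_gt0.
by apply: SmoothAdd; apply: SmoothBase; exact: smooth_flat_affine.
Qed.

(** In each coordinate u = (x_i - p_i) / r, the product
step (2 - u) * step (2 + u) is 1 for |u| <= 1 and 0 for |u| >= 2.  Balls of the
plane are squares, so no smooth norm is needed. *)
Definition box_bump (R : realType) (p : plane R) (r : R) (x : plane R) : R :=
  step (2 - (x.1 - p.1) / r) * step (2 + (x.1 - p.1) / r) *
  (step (2 - (x.2 - p.2) / r) * step (2 + (x.2 - p.2) / r)).

Lemma smooth_box_bump (R : realType) (p : plane R) (r : R) :
  smooth_alg (box_bump p r).
Proof.
rewrite (_ : box_bump p r =
  (@step R \o affine_form (- r^-1) 0 (2 + p.1 / r)) *
  (@step R \o affine_form r^-1 0 (2 - p.1 / r)) *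
  ((@step R \o affine_form 0 (- r^-1) (2 + p.2 / r)) *
   (@step R \o affine_form 0 r^-1 (2 - p.2 / r)))).
  by apply: SmoothMul; apply: SmoothMul; exact: smooth_step_affine.
apply/funext => x; rewrite /box_bump !fctE /affine_form/=.
by congr (step _ * step _ * (step _ * step _)); ring.
Qed.

Lemma box_bump1 (R : realType) (p x : plane R) (r : R) :
  0 < r -> `|p - x| <= r -> box_bump p r x = 1.
Proof.
move=> r0; rewrite prod_normE ge_max => /andP[].
rewrite !ler_distlC => /andP[a1 a2] /andP[b1 b2].
have H u : - r <= u -> u <= r -> step (2 - u / r) * step (2 + u / r) = 1.
  move=> u1 u2.
  have : u / r <= 1 by rewrite ler_pdivrMr// mul1r.
  have : -1 <= u / r by rewrite ler_pdivlMr// mulN1r.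
  by move=> *; rewrite !step_ge1 ?mulr1//; lra.
by rewrite /box_bump !H ?mulr1//; move: a1 a2 b1 b2 => /=; lra.
Qed.

Lemma box_bump0 (R : realType) (p x : plane R) (r : R) :
  0 < r -> 2 * r <= `|p - x| -> box_bump p r x = 0.
Proof.
move=> r0; rewrite prod_normE le_max.
have H u v : 2 * r <= `|u - v| -> step (2 - (v - u) / r) * step (2 + (v - u) / r) = 0.
  rewrite ler_normr => /orP[h|h].
    rewrite [X in _ * X]step_le0 ?mulr0//.
    suff : (v - u) / r <= - 2 by lra.
    by rewrite ler_pdivrMr//; lra.
  rewrite step_le0 ?mul0r//.
  suff : 2 <= (v - u) / r by lra.
  by rewrite ler_pdivlMr//; lra.
by case/orP => /= /H; rewrite /box_bump => ->; rewrite ?mul0r ?mulr0.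
Qed.

Lemma plane_compact (R : realType) (A : set (plane R)) :
  closed A -> bounded_set A -> compact A.
Proof.
move=> cA [M [Mreal AM]].
have MM : M < M + 1 by rewrite ltrDl.
apply: (subclosed_compact cA) (compact_setX (@segment_compact _ (- (M + 1)) (M + 1))
  (@segment_compact _ (- (M + 1)) (M + 1))) _.
move=> x /(AM _ MM); rewrite /Num.Def.normr/= ge_max => /andP[x1 x2].
by split; rewrite /= in_itv/= -ler_norml.
Qed.

Lemma bounded_setU (R : realType) (A B : set (plane R)) :
  bounded_set A -> bounded_set B -> bounded_set (A `|` B).
Proof.
move=> [M [_ AM]] [N [_ BN]]; exists (Num.max M N); split; first exact: num_real.
by move=> x; rewrite gt_max => /andP[Mx Nx] y [/(AM _ Mx)|/(BN _ Nx)].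
Qed.

Lemma bounded_closed_ball (R : realType) (p : plane R) (r : R) :
  bounded_set (closed_ball_ Num.norm p r).
Proof.
exists (`|p| + r); split; first exact: num_real.
move=> x /ltW Mx y /= py; apply: le_trans Mx.
rewrite -[y](subKr p) (le_trans (ler_normB _ _))// lerD2l//.
Qed.

Lemma bounded_subset (R : realType) (A B : set (plane R)) :
  A `<=` B -> bounded_set B -> bounded_set A.
Proof. by move=> AB [M [Mr BM]]; exists M; split => // x Mx y /AB; exact: BM. Qed.

Lemma bounded_closure (R : realType) (A : set (plane R)) :
  bounded_set A -> bounded_set (closure A).
Proof.
move=> [M [_ AM]].
apply: bounded_subset (bounded_closed_ball 0 (M + 1)).
have /closure_id -> := @closed_closed_ball_ _ _ (0 : plane R) (M + 1).
apply: closureS => x Ax.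
by rewrite /closed_ball_/= sub0r normrN; apply: AM => //; rewrite ltrDl.
Qed.

(** The boundary values of a cutoff will be read on the open sets V and
~` C. *)
Definition cutoff (R : realType) (phi : plane R -> R) (V C : set (plane R)) :=
  [/\ smooth_on setT phi, (open V /\ forall x, V x -> phi x = 1),
      closed C, bounded_set C & forall x, ~ C x -> phi x = 0].

(** With phi_p the bump at p, the function 1 - \prod_p (1 - phi_p) is 1 wherever
some factor vanishes, and 0 where all bumps vanish. *)
Lemma cutoff_balls (R : realType) (r : plane R -> R) (s : seq (plane R)) :
  (forall p, p \in s -> 0 < r p) ->
  exists phi, cutoff phi (\bigcup_(p in [set` s]) ball p (r p))
    (\bigcup_(p in [set` s]) closed_ball_ Num.norm p (2 * r p)).
Proof.
elim: s => [|p s IHs] rs.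
  exists (cst 0); rewrite !set_nil !bigcup_set0; split => //.
  - by apply: smooth_alg_smooth; exact: SmoothCst.
  - by split => //; exact: open0.
  - exact: closed0.
  - by exists 0; split => // x _ y [].
have rs' q : q \in s -> 0 < r q.
  by move=> qs; apply: rs; rewrite inE qs orbT.
have [psi [psis [oV V1] cC bC C0]] := IHs rs'.
have rp : 0 < r p by apply: rs; rewrite mem_head.
have -> : [set` p :: s] = [set p] `|` [set` s].
  apply/seteqP; split=> q /=; rewrite inE; last by case=> [->|->]; rewrite ?eqxx ?orbT.
  by move=> /orP[/eqP|]; [left|right].
rewrite !bigcup_setU !bigcup_set1.
exists (cst 1 + cst (-1) * ((cst 1 + cst (-1) * box_bump p (r p)) *
  (cst 1 + cst (-1) * psi))).
split.
- apply: smooth_alg_smooth.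
  have aff f : smooth_alg f ->
      smooth_alg (cst 1 + cst (-1) * f :> (plane R -> R)).
    move=> fs; apply: SmoothAdd; first exact: SmoothCst.
    by apply: SmoothMul => //; exact: SmoothCst.
  apply: (aff); apply: SmoothMul; apply: (aff); first exact: smooth_box_bump.
  exact: SmoothBase.
- split; first by apply: openU => //; exact: ball_open.
  move=> x [px|/V1 psi1].
    rewrite !fctE /= box_bump1//; first ring.
    by rewrite ltW//; move: px; rewrite -ball_normE.
  by rewrite !fctE psi1; ring.
- apply: closedU => //; exact: closed_closed_ball_.
- apply: bounded_setU => //; exact: bounded_closed_ball.
- move=> x /not_orP[px /C0 psi0].
  rewrite !fctE psi0 box_bump0//; first ring.
  by rewrite leNgt; apply/negP => h; apply: px; exact: ltW.
Qed.

(** Smooth Urysohn lemma: finitely many squares cover K while their doubles stay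
in U. *)
Lemma exists_cutoff (R : realType) (K U : set (plane R)) :
  compact K -> open U -> K `<=` U ->
  exists phi V C, [/\ cutoff phi V C, K `<=` V & C `<=` U].
Proof.
move=> cK oU KU.
have [|r rP] := @choice (plane R) R (fun p y =>
    0 < y /\ (U p -> closed_ball_ Num.norm p (2 * y) `<=` U)).
  move=> p; have [Up|nUp] := pselect (U p); last by exists 1.
  have /nbhs_ballP[e /= e0 eU] : nbhs p U by exact: open_nbhs_nbhs.
  (* e / 4 makes the closed ball of twice this radius fit in the ball e. *)
  exists (e / 4); split=> [|_ x /= px]; first by rewrite divr_gt0.
  by apply: eU; rewrite -ball_normE/=; apply: (le_lt_trans px); lra.
have : @cover_compact (plane R : normedModType R) K by rewrite -compact_cover.
move=> /(_ (plane R) K (fun p => ball p (r p))).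
case=> [p _|p Kp|D DK KD]; first exact: ball_open.
  by exists p => //; apply: ballxx; case: (rP p).
have [phi phiP] := @cutoff_balls R r (finmap.enum_fset D) (fun p _ => (rP p).1).
exists phi; do 2 eexists; split; [exact: phiP|exact: KD|].
move=> x [p pD]; apply: (rP p).2; apply: KU.
by have /set_mem := DK _ pD.
Qed.

(** * The boundary of an exterior domain *)

(** Otherwise A would be open and closed, and a horizontal line through a point
of A, being connected, would lie in the bounded set A. *)
Lemma boundary_nonempty (R : realType) (A : set (plane R)) :
  open A -> bounded_set A -> A !=set0 -> boundary A !=set0.
Proof.
move=> oA [M [_ AM]] [p Ap]; apply/set0P/eqP => A0.
have cA : closed A.
  move=> x clx; apply: contrapT => nAx.
  have : boundary A x by split => // /interior_subset.
  by rewrite A0.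
have ci : continuous (fun t : R => (t, p.2) : plane R).
  by move=> t; apply: (cvg_pair (@cvg_id _ _) (@cvg_cst _ p.2 _ _ _)).
have /connected_intervalP ciT : is_interval [set: R] by [].
pose T := [set t : R | A (t, p.2)].
have /seteqP[_ TT] : T = setT.
  apply: ciT; first by exists p.1; rewrite /T/= -surjective_pairing.
  - exists T; rewrite ?setTI//.
    by move/continuousP : ci => /(_ _ oA).
  - exists T; rewrite ?setTI//.
    by move/continuous_closedP : ci => /(_ _ cA).
have /AM : M < `|M| + 1 by rewrite ltr_pwDr// ler_norm.
move=> /(_ _ (TT (`|M| + 2) I)).
rewrite /Num.Def.normr/= ge_max => /andP[+ _].
by move=> /= h; have := le_trans (ler_norm _) h; lra.
Qed.

Section exterior_domain.
Variables (R : realType) (k : nat) (Om : set (plane R))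
  (Omj : 'I_k -> set (plane R)).
Hypothesis Om_ext : smooth_exterior_domain Om Omj.

Let hole_disjoint_closure j x : Omj j x -> ~ closure Om x.
Proof.
move=> jx; rewrite -[~ _]/((~` closure Om) x) (sed_hole_cover Om_ext).
by exists j.
Qed.

Let hole_of x : ~ closure Om x -> exists j, Omj j x.
Proof.
rewrite -[~ _]/((~` closure Om) x) (sed_hole_cover Om_ext) => -[j _].
by exists j.
Qed.

(** A boundary point of a hole lies in no hole, since the closures of the holes
are disjoint; and Om, being open, would meet the hole if it contained the
point. *)
Lemma hole_boundary_sub j : boundary (Omj j) `<=` closure Om `\` Om.
Proof.
move=> x [cx nx]; split.
  apply: contrapT => /hole_of[i ix].
  have [ij|ij] := eqVneq i j.
    apply: nx; apply: open_nbhs_nbhs; split; last by rewrite -ij.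
    exact: (sed_hole_open Om_ext).
  have : (closure (Omj i) `&` closure (Omj j)) x by split => //; exact: subset_closure.
  by rewrite (sed_hole_disjoint Om_ext).
move=> Omx; have [y [jy Omy]] := cx _ (open_nbhs_nbhs (conj (sed_open Om_ext) Omx)).
by apply: (hole_disjoint_closure jy); exact: subset_closure.
Qed.

Lemma hole_boundary_nonempty j : boundary (Omj j) !=set0.
Proof.
apply: boundary_nonempty; first exact: (sed_hole_open Om_ext).
- exact: (sed_hole_bounded Om_ext).
- by case: (sed_hole_simply_connected Om_ext j).
Qed.

(** Smoothness of the boundary excludes slits and punctures: moving from a
boundary point p away from the graph, one leaves the closure of Om, hence
enters a hole.  So p is a limit of points of the holes, and the finitely many
hole closures have closed union. *)
Lemma domain_boundary_sub : closure Om `\` Om `<=` \bigcup_j boundary (Omj j).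
Proof.
move=> p [clp nOmp].
have oOm := sed_open Om_ext.
have clU : closure (\bigcup_j Omj j) p.
  have [] := sed_smooth Om_ext (p := p).
    by split => // /interior_subset.
  move=> g [swap [flip [smg /nbhs_ballP[e /= e0 eOm]]]].
  have gc : continuous g.
    by move=> t; apply/differentiable_continuous/derivable1_diffP; exact: (smg 0%N).
  rewrite -(sed_hole_cover Om_ext) => B /nbhs_ballP[d /= d0 dB].
  (* Near p, the domain is h < 0. *)
  pose co (x : plane R) := if swap then (x.2, x.1) else x.
  pose h x := g (co x).1 - (-1) ^+ flip * (co x).2.
  have OmE x : ball p e x -> Om x <-> h x < 0.
    by move=> /eOm/= ->; rewrite /h subr_lt0.
  have hp : 0 <= h p.
    by rewrite leNgt; apply/negP => /(OmE _ (ballxx _ e0)).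
  (* q is p moved by m < min e d so that h increases: it stays in the ball
     where the domain is h < 0, and in the given neighbourhood B. *)
  pose m := Num.min e d / 2.
  have m0 : 0 < m by rewrite divr_gt0// lt_min e0.
  pose s : R := - (-1) ^+ flip * m.
  pose q : plane R := if swap then (p.1 + s, p.2) else (p.1, p.2 + s).
  have hq : 0 < h q.
    apply: (le_lt_trans hp).
    have -> : h q = h p + m.
      rewrite /h /q /co /s; case: (swap) => /=;
      by case: (flip); rewrite ?expr0 ?expr1; ring.
    by rewrite ltrDl.
  have sm : `|s| = m.
    by rewrite /s normrM normrN normrX normrN1 expr1n mul1r gtr0_norm.
  have pq : `|p - q| = m.
    have -> : p - q = if swap then (- s, 0) else (0, - s).
      by rewrite /q; case: (swap); apply: injective_projections => /=; ring.
    case: (swap); rewrite prod_normE/= normr0 normrN sm.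
    - exact/max_l/ltW.
    - exact/max_r/ltW.
  have hc : {for q, continuous h}.
    have co1 : continuous (fun x => (co x).1).
      by rewrite /co; case: (swap) => x; [exact: cvg_snd|exact: cvg_fst].
    have co2 : continuous (fun x => (co x).2).
      by rewrite /co; case: (swap) => x; [exact: cvg_fst|exact: cvg_snd].
    apply: cvgB; last by apply: cvgM; [exact: cvg_cst|exact: co2].
    by apply: continuous_comp; [exact: co1|exact: gc].
  have [me md] : m < e /\ m < d.
    have : Num.min e d <= e by rewrite ge_min lexx.
    have : Num.min e d <= d by rewrite ge_min lexx orbT.
    by split; rewrite /m; lra.
  exists q; split; last first.
    by apply: dB; rewrite -ball_normE/= pq.
  move=> clq; have : nbhs q [set x | 0 < h x /\ ball p e x].
    apply: filterI.
      exact: (hc _ (lt_nbhsr hq)).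
    apply: open_nbhs_nbhs; split; first exact: ball_open.
    by rewrite -ball_normE/= pq.
  move=> /clq[y [Omy [hy /OmE[/(_ Omy) + _]]]].
  by rewrite ltNge (ltW hy).
have cU : closed (\bigcup_j closure (Omj j)).
  apply: closed_bigcup => [|j _]; [exact: finite_finset|exact: closed_closure].
have [j _ jp] : (\bigcup_j closure (Omj j)) p.
  apply: cU; apply: closureS clU => y [j _ jy].
  by exists j => //; exact: subset_closure.
exists j => //; split => // /interior_subset jp'.
exact: hole_disjoint_closure jp' clp.
Qed.

End exterior_domain.

(** * Measurability and integrability *)

(** An open set is the countable union of the rational rectangles that it
contains; this links the topology of the plane to the product
sigma-algebra. *)
Lemma plane_open_measurable (R : realType) (U : set (plane R)) :
  open U -> measurable (U : set (mplane R)).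
Proof.
move=> oU.
pose B (q : (rat * rat) * (rat * rat)) : set (mplane R) :=
  `]ratr q.1.1, ratr q.1.2[%classic `*` `]ratr q.2.1, ratr q.2.2[%classic.
pose F q := if pselect (B q `<=` U) then B q else set0.
have -> : U = \bigcup_q F q.
  apply/seteqP; split=> [x Ux|x [q _]]; last by rewrite /F; case: pselect => // BU /BU.
  have /nbhs_ballP[e /= e0 eU] : nbhs x U by exact: open_nbhs_nbhs.
  have lo (t : R) : t - e < t by rewrite ltrBlDr ltrDl.
  have hi (t : R) : t < t + e by rewrite ltrDl.
  have [a1] := rat_in_itvoo (lo x.1); rewrite in_itv/= => /andP[la1 ua1].
  have [b1] := rat_in_itvoo (hi x.1); rewrite in_itv/= => /andP[lb1 ub1].
  have [a2] := rat_in_itvoo (lo x.2); rewrite in_itv/= => /andP[la2 ua2].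
  have [b2] := rat_in_itvoo (hi x.2); rewrite in_itv/= => /andP[lb2 ub2].
  have BU : B ((a1, b1), (a2, b2)) `<=` U.
    move=> y; rewrite /B/= !in_itv/= => -[/andP[ly1 uy1] /andP[ly2 uy2]].
    by apply: eU; split; rewrite -ball_normE/= ltr_norml; apply/andP; split; lra.
  exists ((a1, b1), (a2, b2)) => //; rewrite /F; case: pselect => //= _.
  by split; rewrite /= in_itv/=; apply/andP.
apply: countable_bigcupT_measurable => [|q]; first exact: countableP.
by rewrite /F; case: pselect => /= _ //; apply: measurableX; exact: measurable_itv.
Qed.

Lemma plane_closed_measurable (R : realType) (C : set (plane R)) :
  closed C -> measurable (C : set (mplane R)).
Proof.
by move=> cC; rewrite -(setCK C); apply: measurableC;
  apply: plane_open_measurable; exact: closed_openC.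
Qed.

Lemma plane_continuous_measurable (R : realType) (D : set (mplane R)) (f : plane R -> R) :
  measurable D -> continuous f -> measurable_fun D (f : mplane R -> R).
Proof.
move=> mD cf; apply: (@measurable_funS _ _ _ _ setT) => //.
apply: (measurability _ (measurable_realfun.RGenOpens.measurableE R)).
move=> _ [_ [a [b ->]] <-]; rewrite setTI.
apply: plane_open_measurable; move/continuousP : cf; apply.
exact: interval_open.
Qed.

Lemma continuous_bounded_on (R : realType) (K : set (plane R)) (f : plane R -> R) :
  continuous f -> compact K -> [bounded f x | x in K].
Proof.
move=> cf cK.
have /compact_bounded : compact (f @` K).
  by apply: continuous_compact => //; exact: continuous_subspaceT.
by move=> [M [Mr fM]]; exists M; split => // x Mx y Ky; apply: (fM _ Mx); exists y.
Qed.

(** Since u vanishes on Om outside K, the integral over Om is one over K, where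
h is integrable and u is bounded. *)
Lemma integrable_L1loc_mul (R : realType) (Om K : set (plane R))
    (h u : plane R -> R) :
  open Om -> L1loc Om h -> compact K -> K `<=` Om -> continuous u ->
  (forall x, Om x -> ~ K x -> u x = 0) ->
  (lebesgue2 R).-integrable (Om : set (mplane R)) (fun x => (h x * u x)%:E).
Proof.
move=> oOm [_ hloc] cK KOm cu u0.
have mK : measurable (K : set (mplane R)).
  by apply: plane_closed_measurable; apply: compact_closed => //; exact: norm_hausdorff.
apply/integrable_mkcond; first exact: plane_open_measurable.
have -> : (fun x => (h x * u x)%:E) \_ Om = (fun x => (h x * u x)%:E) \_ K.
  apply/funext => x; rewrite !patchE; have [xK|xK] := boolP (x \in K).
    by rewrite (mem_set (KOm _ (set_mem xK))).
  by case: ifPn => // /set_mem xO; rewrite u0 ?mulr0// => /mem_set; apply/negP.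
apply/(integrable_mkcond _ mK).
have := integrableMl mK (hloc _ cK KOm) (plane_continuous_measurable mK cu)
  (continuous_bounded_on cu cK).
by apply: eq_integrable.
Qed.

(** Both parts of the Jordan decomposition are finite measures, for which bounded
measurable functions are integrable. *)
Lemma charge_integral_linear d (T : measurableType d) (R : realType)
    (w : {charge set T -> \bar R}) (D : set T) (f g : T -> R) (a : R) :
  measurable D -> measurable_fun D f -> measurable_fun D g ->
  [bounded f x | x in D] -> [bounded g x | x in D] ->
  charge_integral w D (fun x => f x + a * g x) =
  charge_integral w D f + a * charge_integral w D g.
Proof.
move=> mD mf mg bf bg.
have I (mu : {finite_measure set T -> \bar R}) (h : T -> R) :
    measurable_fun D h -> [bounded h x | x in D] ->
    mu.-integrable D (EFin \o h).
  move=> mh bh; apply: measurable_bounded_integrable => //.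
  by rewrite ltey_eq fin_num_measure.
have L (mu : {finite_measure set T -> \bar R}) :
    \int[mu]_(x in D) (f x + a * g x) =
    \int[mu]_(x in D) f x + a * \int[mu]_(x in D) g x.
  rewrite RintegralD ?RintegralZl//; try exact: I.
  by have := integrableZl mD a (I mu g mg bg); apply: eq_integrable.
rewrite /charge_integral; set P := svalP _; set N := svalP _.
by rewrite !L; ring.
Qed.

(** * The test space and its boundary values *)

Lemma value_onE (R : realType) (f : plane R -> R) (G : set (plane R)) (c : R) :
  G !=set0 -> (forall x, G x -> f x = c) -> value_on f G = c.
Proof.
move=> [p Gp] fc; rewrite /value_on.
have := @xgetPex _ 0 [set c | forall x, G x -> f x = c] (ex_intro _ c fc).
by move=> /(_ p Gp) <-; exact: fc.
Qed.

Section test_space.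
Variables (R : realType) (k : nat) (Om : set (plane R))
  (Omj : 'I_k -> set (plane R)).
Hypothesis Om_ext : smooth_exterior_domain Om Omj.

Definition trace (phi : plane R -> R) (j : 'I_k) : R :=
  value_on phi (boundary (Omj j)).

(** The third clause of [Yoo] with the hole and the constant made explicit, so
that the constant can be compared with [trace]. *)
Definition constant_near_hole (phi : plane R -> R) (j : 'I_k) (c : R) :=
  exists U, [/\ open U, boundary (Omj j) `<=` U &
    forall x, U x -> closure Om x -> phi x = c].

(** [value_on] recovers the constant because the hole boundary is nonempty and
contained in the closure of Om. *)
Lemma trace_unique phi j c : constant_near_hole phi j c -> trace phi j = c.
Proof.
move=> [U [_ GU Uc]]; apply: value_onE; first exact: hole_boundary_nonempty Om_ext j.
by move=> x Gx; apply: Uc; [exact: GU|case: (hole_boundary_sub Om_ext Gx)].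
Qed.

Lemma Yoo_trace phi j : Yoo Om Omj phi -> constant_near_hole phi j (trace phi j).
Proof.
move=> [_ _ /(_ j)[U [c [oU GU Uc]]]].
have H : constant_near_hole phi j c by exists U.
by rewrite (trace_unique H).
Qed.

Lemma constant_near_hole_linear phi psi j a b c :
  constant_near_hole phi j b -> constant_near_hole psi j c ->
  constant_near_hole (phi + a \*o psi) j (b + a * c).
Proof.
move=> [U [oU GU Ub]] [V [oV GV Vc]]; exists (U `&` V); split.
- exact: openI.
- by move=> x Gx; split; [exact: GU|exact: GV].
- by move=> x [Ux Vx] clx; rewrite !fctE/= Ub// Vc.
Qed.

Lemma Yoo_linear phi psi a : Yoo Om Omj phi -> Yoo Om Omj psi ->
  Yoo Om Omj (phi + a \*o psi).
Proof.
move=> Yphi Ypsi; split.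
- case: Yphi => -[f fs phif] _ _; case: Ypsi => -[g gs psig] _ _.
  exists (f + cst a * g) => [|x clx]; last by rewrite !fctE/= phif// psig.
  apply: smooth_alg_smooth; apply: SmoothAdd; first exact: SmoothBase.
  by apply: SmoothMul; [exact: SmoothCst|exact: SmoothBase].
- case: Yphi => _ b1 _; case: Ypsi => _ b2 _.
  apply: bounded_subset (bounded_setU b1 b2).
  move=> x /= [clx]; rewrite !fctE/=.
  have [-> |] := eqVneq (phi x) 0; last by left.
  by have [->|] := eqVneq (psi x) 0; [rewrite mulr0 addr0 eqxx|right].
- move=> j; have [U [oU GU Uc]] :=
    constant_near_hole_linear a (Yoo_trace j Yphi) (Yoo_trace j Ypsi).
  by exists U, (trace phi j + a * trace psi j).
Qed.

Lemma trace_linear phi psi a j : Yoo Om Omj phi -> Yoo Om Omj psi ->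
  trace (phi + a \*o psi) j = trace phi j + a * trace psi j.
Proof.
move=> Yphi Ypsi; apply: trace_unique.
by apply: constant_near_hole_linear; exact: Yoo_trace.
Qed.

Lemma Yoo0 : Yoo Om Omj (cst 0).
Proof.
split.
- by exists (cst 0) => //; apply: smooth_alg_smooth; exact: SmoothCst.
- by exists 0; split => // x _ y [_]; rewrite eqxx.
- by move=> j; exists setT, 0; split => //; exact: openT.
Qed.

(** A cutoff equal to 1 around the closure of the hole j and supported away from
the closures of the others. *)
Lemma Yoo_cutoff j : exists2 chi, Yoo Om Omj chi &
  forall i, trace chi i = (i == j)%:R.
Proof.
pose U := ~` (\bigcup_(i in [set i | i != j]) closure (Omj i)).
have bcl := bounded_closure (sed_hole_bounded Om_ext j).
have [|||phi [V [C [[phis [oV V1] cC bC C0] KV CU]]]] :=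
  @exists_cutoff R (closure (Omj j)) U.
- by apply: plane_compact => //; exact: closed_closure.
- apply: closed_openC; apply: closed_bigcup => [|i _]; last exact: closed_closure.
  exact: finite_finset.
- move=> x jx [i /= ij ix].
  have : (closure (Omj i) `&` closure (Omj j)) x by [].
  by rewrite (sed_hole_disjoint Om_ext).
have chole i : constant_near_hole phi i (i == j)%:R.
  have [->|ij] := eqVneq i j.
    by exists V; split => [//|x [/KV]//|x Vx _]; exact: V1.
  exists (~` C); split => [|x [ix _] /CU|x Cx _]; [exact: closed_openC| |exact: C0].
  by apply; exists i.
exists phi; last by move=> i; exact: trace_unique.
split; first by exists phi.
- apply: bounded_subset bC => x [_ x0]; apply: contrapT => /C0 E.
  by rewrite E eqxx in x0.
- by move=> i; have [W [oW GW Wc]] := chole i; exists W, (i == j)%:R.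
Qed.

End test_space.

(** * The defect in Green's formula *)

Section circulation.
Variables (R : realType) (k : nat) (Om : set (plane R))
  (Omj : 'I_k -> set (plane R)).
Hypothesis Om_ext : smooth_exterior_domain Om Omj.

Let oOm : open Om. Proof. exact: (sed_open Om_ext). Qed.

(** K is the closure of Om minus the neighbourhoods of the hole boundaries where
phi is constant, and minus the exterior of a large ball, where phi is 0.  It
avoids the boundary of Om because that boundary is made of the hole
boundaries.  The constants off K are recorded, to know that phi vanishes there
when its boundary values do. *)
Lemma Yoo_locally_constant phi : Yoo Om Omj phi -> exists K : set (plane R),
  [/\ compact K, K `<=` Om &
    forall x, Om x -> ~ K x -> exists2 c, \near x, phi x = c &
      c = 0 \/ exists j, c = trace Omj phi j].
Proof.
move=> Yphi.
have [U UP] := @choice 'I_k (set (plane R)) _ (fun j => Yoo_trace Om_ext j Yphi).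
case: Yphi => _ [M [_ HM]] _.
pose K := closure Om `&` (closed_ball_ Num.norm 0 (M + 1) `&` ~` \bigcup_j U j).
have oU : open (\bigcup_j U j) by apply: bigcup_open => j _; case: (UP j).
have E x : Om x -> closure Om x by exact: subset_closure.
exists K; split.
- apply: plane_compact.
    apply: closedI; first exact: closed_closure.
    by apply: closedI; [exact: closed_closed_ball_|exact: open_closedC].
  apply: bounded_subset (bounded_closed_ball 0 (M + 1)).
  by move=> x [_ []].
- move=> x [clx [_ nU]]; apply: contrapT => nOm.
  have [j _ jx] := domain_boundary_sub Om_ext (conj clx nOm).
  by apply: nU; exists j => //; case: (UP j) => _ + _; exact.
- move=> x Omx nK.
  have nO : nbhs x Om by exact: open_nbhs_nbhs.
  have [[j _ jx]|nU] := pselect ((\bigcup_j U j) x).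
    exists (trace Omj phi j); last by right; exists j.
    have [oj _ Uc] := UP j.
    have nj : nbhs x (U j) by exact: open_nbhs_nbhs.
    by apply: filterS (filterI nj nO) => y [jy /E Oy]; exact: Uc.
  exists 0; last by left.
  have nb : nbhs x (~` closed_ball_ Num.norm 0 (M + 1)).
    apply: open_nbhs_nbhs; split.
      by apply: closed_openC; exact: closed_closed_ball_.
    by move=> bx; apply: nK; split; [exact: E|].
  apply: filterS (filterI nb nO) => y [nby /E Oy].
  apply: contrapT => /eqP y0; apply: nby.
  by rewrite /closed_ball_/= sub0r normrN; apply: HM => //; rewrite ltrDl.
Qed.

Variables (v : plane R -> plane R) (w : {charge set (mplane R) -> \bar R}).
Hypotheses (v_L1loc : L1loc_field Om v) (curl_v : curl_is Om v w).

Let mOm : measurable (Om : set (mplane R)).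
Proof. exact: plane_open_measurable. Qed.

Lemma Yoo_measurable phi : Yoo Om Omj phi ->
  measurable_fun (Om : set (mplane R)) (phi : mplane R -> R).
Proof.
move=> [[g gs phig] _ _].
have := plane_continuous_measurable mOm (smooth_onT_continuous gs).
apply: eq_measurable_fun => x /set_mem Ox; rewrite phig//.
exact: subset_closure.
Qed.

Lemma Yoo_bounded phi : Yoo Om Omj phi -> [bounded phi x | x in Om].
Proof.
move=> [[g gs phig] bphi _].
have cK : compact (closure [set x | closure Om x /\ phi x != 0]).
  apply: plane_compact; first exact: closed_closure.
  exact: bounded_closure.
have [M [_ HM]] := continuous_bounded_on (smooth_onT_continuous gs) cK.
exists (Num.max M 0); split; first exact: num_real.
move=> x; rewrite gt_max => /andP[Mx x0] y Oy /=.
have cy : closure Om y by exact: subset_closure.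
have [->|y0] := eqVneq (phi y) 0; first by rewrite normr0 ltW.
by rewrite phig//; apply: HM => //; exact: subset_closure.
Qed.

Lemma Yoo_derivable phi i (x : plane R) : Yoo Om Omj phi -> Om x ->
  derivable phi x (axis R i).
Proof.
move=> [[g gs phig] _ _] Ox.
have nO : nbhs x Om by exact: open_nbhs_nbhs.
have E : \near x, g x = phi x.
  by apply: filterS nO => y Oy; rewrite phig//; exact: subset_closure.

exact: near_eq_derivable E (smooth_onT_derivable gs).
Qed.

Lemma Yoo_derive_linear phi psi a i (x : plane R) :
  Yoo Om Omj phi -> Yoo Om Omj psi -> Om x ->
  'D_(axis R i) (phi + a \*o psi) x =
  'D_(axis R i) phi x + a * 'D_(axis R i) psi x.
Proof.
move=> Yphi Ypsi Ox.
have d1 := Yoo_derivable (i := i) Yphi Ox.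
have d2 := Yoo_derivable (i := i) Ypsi Ox.
rewrite deriveD//; last exact: (@derivableZ _ _ _ psi a x _ d2).
by rewrite deriveMl.
Qed.

(** The derivative of phi is that of a globally smooth extension g, which
vanishes on Om outside a compact set. *)
Lemma Yoo_partial_integrable phi (h : plane R -> R) i : Yoo Om Omj phi ->
  L1loc Om h ->
  (lebesgue2 R).-integrable (Om : set (mplane R))
    (fun x => (h x * 'D_(axis R i) phi x)%:E).
Proof.
move=> Yphi hloc; have [K [cK KO Kc]] := Yoo_locally_constant Yphi.
have [[g gs phig] _ _] := Yphi.
have E x : Om x -> \near x, phi x = g x.
  move=> Ox; have nO : nbhs x Om by exact: open_nbhs_nbhs.
  by apply: filterS nO => y Oy; apply: phig; exact: subset_closure.
have u0 x : Om x -> ~ K x -> 'D_(axis R i) g x = 0.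
  move=> Ox /(Kc x Ox)[c phic _].
  by rewrite -(near_eq_derive _ (E x Ox)) (@near_eq_derive _ _ _ _ (cst c))// derive_cst.
have := integrable_L1loc_mul oOm hloc cK KO
  (smooth_onT_continuous (smooth_onT_derive i gs)) u0.
apply: eq_integrable => // x /set_mem Ox.
by rewrite (near_eq_derive _ (E x Ox)).
Qed.

(** The left-hand side of Green's formula: for smooth v and w = curl v it is a
sum of integrals over the hole boundaries. *)
Definition curl_defect (phi : plane R -> R) : R :=
  charge_integral w Om phi
    + \int[lebesgue2 R]_(x in Om) dot (v x) (grad_perp phi x).

Lemma curl_defectE phi : Yoo Om Omj phi ->
  curl_defect phi = charge_integral w Om phi
    - \int[lebesgue2 R]_(x in Om) ((v x).1 * partial2 phi x)
    + \int[lebesgue2 R]_(x in Om) ((v x).2 * partial1 phi x).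
Proof.
move=> Yphi; case: v_L1loc => v1 v2.
have I1 := Yoo_partial_integrable true Yphi v1.
have I2 := Yoo_partial_integrable false Yphi v2.
have E : \int[lebesgue2 R]_(x in Om) dot (v x) (grad_perp phi x) =
    \int[lebesgue2 R]_(x in Om) ((v x).2 * partial1 phi x) -
    \int[lebesgue2 R]_(x in Om) ((v x).1 * partial2 phi x).
  rewrite -RintegralB//; apply: eq_Rintegral => x _.
  by rewrite /dot /grad_perp/= mulrN addrC.
by rewrite /curl_defect E addrA addrAC.
Qed.

Lemma curl_defect_linear phi psi a : Yoo Om Omj phi -> Yoo Om Omj psi ->
  curl_defect (phi + a \*o psi) = curl_defect phi + a * curl_defect psi.
Proof.
move=> Yphi Ypsi; have Y := Yoo_linear Om_ext a Yphi Ypsi.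
have L h i : L1loc Om h ->
    \int[lebesgue2 R]_(x in Om) (h x * 'D_(axis R i) (phi + a \*o psi) x) =
    \int[lebesgue2 R]_(x in Om) (h x * 'D_(axis R i) phi x) +
    a * \int[lebesgue2 R]_(x in Om) (h x * 'D_(axis R i) psi x).
  move=> hloc.
  have I1 := Yoo_partial_integrable i Yphi hloc.
  have I2 := Yoo_partial_integrable i Ypsi hloc.
  rewrite -RintegralZl// -RintegralD//; last first.
    by have := integrableZl mOm a I2; apply: eq_integrable.
  apply: eq_Rintegral => x /set_mem Ox.
  by rewrite (Yoo_derive_linear a i Yphi Ypsi Ox) mulrDr mulrCA.
have [v1 v2] := v_L1loc.
rewrite (curl_defectE Y) (curl_defectE Yphi) (curl_defectE Ypsi).
have E1 : \int[lebesgue2 R]_(x in Om) ((v x).1 * partial2 (phi + a \*o psi) x) =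
    \int[lebesgue2 R]_(x in Om) ((v x).1 * partial2 phi x) +
    a * \int[lebesgue2 R]_(x in Om) ((v x).1 * partial2 psi x) := L _ true v1.
have E2 : \int[lebesgue2 R]_(x in Om) ((v x).2 * partial1 (phi + a \*o psi) x) =
    \int[lebesgue2 R]_(x in Om) ((v x).2 * partial1 phi x) +
    a * \int[lebesgue2 R]_(x in Om) ((v x).2 * partial1 psi x) := L _ false v2.
rewrite {}E1 {}E2.
have -> : charge_integral w Om (phi + a \*o psi) =
    charge_integral w Om phi + a * charge_integral w Om psi.
  apply: charge_integral_linear => //; try exact: Yoo_measurable;
    exact: Yoo_bounded.
have alg (p q A B C D : R) : p + a * q - (A + a * B) + (C + a * D) =
    p - A + C + a * (q - B + D) by ring.
exact: alg.
Qed.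

(** The extension of phi by zero is locally either a smooth extension of phi (in
Om) or 0 (off K), and its support is in K: it is a test function, so the curl
identity applies to it. *)
Lemma curl_defect_trace0 phi : Yoo Om Omj phi -> (forall j, trace Omj phi j = 0) ->
  curl_defect phi = 0.
Proof.
move=> Yphi tr0; have [K [cK KO Kc]] := Yoo_locally_constant Yphi.
have clK : closed K by apply: compact_closed => //; exact: norm_hausdorff.
pose f : plane R -> R := phi \_ Om.
have f0 x : ~ K x -> \near x, f x = 0.
  move=> nK; have nCK : nbhs x (~` K).
    by apply: open_nbhs_nbhs; split => //; exact: closed_openC.
  apply: filterS nCK => y nKy; rewrite /f patchE; case: ifPn => // /set_mem Oy.
  have [c /nbhs_singleton -> [//|[j ->]]] := Kc y Oy nKy.
  exact: tr0.
have nf x : Om x -> \near x, f x = phi x.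
  move=> Ox; have nO : nbhs x Om by exact: open_nbhs_nbhs.
  by apply: filterS nO => y Oy; rewrite /f patchE mem_set.
have suppK : closure [set x | f x != 0] `<=` K.
  rewrite [X in _ `<=` X](closure_id _).1//; apply: closureS => x /=.
  by move=> fx; apply: contrapT => /f0/nbhs_singleton E; rewrite E eqxx in fx.
have ft : test_function Om f.
  split.
  - apply: smooth_onT_local => x; have [Ox|nOx] := pselect (Om x).
      have [[g gs phig] _ _] := Yphi; exists g => //.
      have nO : nbhs x Om by exact: open_nbhs_nbhs.
      apply: filterS nO => y Oy; rewrite /f patchE mem_set// phig//.
      exact: subset_closure.
    exists (cst 0); first by apply: smooth_alg_smooth; exact: SmoothCst.
    by apply: f0 => /KO.
  - by apply: subclosed_compact cK suppK; exact: closed_closure.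
  - by move=> x /suppK/KO.
rewrite curl_defectE//.
have -> : charge_integral w Om phi = charge_integral w Om f.
  by congr (_ - _); apply: eq_Rintegral => x xO; rewrite /f patchE xO.
have D h i : \int[lebesgue2 R]_(x in Om) (h x * 'D_(axis R i) phi x) =
    \int[lebesgue2 R]_(x in Om) (h x * 'D_(axis R i) f x).
  apply: eq_Rintegral => x /set_mem Ox.
  by rewrite (near_eq_derive _ (nf x Ox)).
have -> : \int[lebesgue2 R]_(x in Om) ((v x).1 * partial2 phi x) =
    \int[lebesgue2 R]_(x in Om) ((v x).1 * partial2 f x) := D _ true.
have -> : \int[lebesgue2 R]_(x in Om) ((v x).2 * partial1 phi x) =
    \int[lebesgue2 R]_(x in Om) ((v x).2 * partial1 f x) := D _ false.
by rewrite -(curl_v ft) addrK addNr.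
Qed.

(** Induction on s produces the combination together with its boundary values,
which is all that the comparison with a given phi uses. *)
Lemma curl_defect_lincomb (chi : 'I_k -> plane R -> R) (c : 'I_k -> R) (s : seq 'I_k) :
  (forall j, Yoo Om Omj (chi j)) ->
  exists S, [/\ Yoo Om Omj S, curl_defect S = \sum_(j <- s) c j * curl_defect (chi j) &
    forall i, trace Omj S i = \sum_(j <- s) c j * trace Omj (chi j) i].
Proof.
move=> Ychi; elim: s => [|j s [S [YS cS tS]]].
  have t0 i : trace Omj (cst 0) i = 0.
    by apply: (trace_unique Om_ext); exists setT; split => //; exact: openT.
  have Y0 := Yoo0 Om Omj.
  exists (cst 0); split => // [|i]; rewrite big_nil ?t0//.
  exact: curl_defect_trace0.
exists (S + c j \*o chi j); split => [||i]; first exact: Yoo_linear.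
  by rewrite curl_defect_linear// cS big_cons addrC.
by rewrite (trace_linear Om_ext)// tS big_cons addrC.
Qed.

End circulation.

Theorem lemma4p2 (R : realType) (k : nat) (k_gt0 : (0 < k)%N)
  (Om : set (plane R)) (Omj : 'I_k -> set (plane R))
  (Om_ext : smooth_exterior_domain Om Omj)
  (disk_sub : @unit_disk R `<=` Omj (Ordinal k_gt0))
  (v : plane R -> plane R) (w : {charge set (mplane R) -> \bar R})
  (v_L1loc : L1loc_field Om v)
  (w_Om : charge_on Om w) (curl_v : curl_is Om v w) :
  exists! gamma : 'I_k -> R, forall phi : plane R -> R, Yoo Om Omj phi ->
    charge_integral w Om phi
    + \int[lebesgue2 R]_(x in Om) dot (v x) (grad_perp phi x)
    = - \sum_(j < k) gamma j * value_on phi (boundary (Omj j)).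
Proof.
have [chi chiP] := @choice 'I_k (plane R -> R)
  (fun j f => Yoo Om Omj f /\ forall i, trace Omj f i = (i == j)%:R)
  (fun j => let: ex_intro2 f Yf tf := Yoo_cutoff Om_ext j in
            ex_intro _ f (conj Yf tf)).
have Ychi j : Yoo Om Omj (chi j) by case: (chiP j).
have tchi j i : trace Omj (chi j) i = (i == j)%:R by case: (chiP j).
exists (fun j => - curl_defect Om v w (chi j)); split=> [phi Yphi|gamma Hgamma].
(* S is the combination of the cutoffs with the boundary values of phi. *)
- have [S [YS cS tS]] := curl_defect_lincomb Om_ext v_L1loc curl_v
    (trace Omj phi) (index_enum 'I_k) Ychi.
  have tSphi i : trace Omj S i = trace Omj phi i.
    rewrite tS (bigD1 i)//= tchi eqxx mulr1 big1 ?addr0// => j ji.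
    by rewrite tchi eq_sym (negbTE ji) mulr0.
  have Ydiff := Yoo_linear Om_ext (-1) Yphi YS.
  have : curl_defect Om v w (phi + -1 \*o S) = 0.
    apply: (curl_defect_trace0 Om_ext) => // j.
    by rewrite (trace_linear Om_ext)// tSphi mulN1r subrr.
  rewrite (curl_defect_linear Om_ext)// mulN1r => /subr0_eq.
  rewrite /curl_defect => ->; rewrite -/(curl_defect _ _ _ _) cS -sumrN.
  by apply: eq_bigr => j _; rewrite mulNr opprK mulrC.
- apply/funext => j.
  have := Hgamma (chi j) (Ychi j); rewrite -/(curl_defect _ _ _ _) => ->.
  rewrite opprK (bigD1 j)//= -/(trace _ _ _) tchi eqxx mulr1.
  by rewrite big1 ?addr0// => i ij; rewrite -/(trace _ _ _) tchi (negbTE ij) mulr0.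
Qed.
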